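(* Let $I$ be an isotropic distribution of vector fields on $(M,g)$ and let $\hat{\nabla}$ be any spinorial connection. Then $I$ is integrable and its leaves are totally geodesic submanifolds if and only if $\hat{\nabla}_X\hat{\varphi}$ belongs to $\hat{L}_{I}$ for all vector fields $X$ in $I$ and all spinor fields $\hat{\varphi}$ in $\hat{L}_{I}$.
   Context: $(M,g)$ is a smooth $2n$-dimensional manifold with a non-degenerate metric $g$ of arbitrary signature; $\nabla$ is its Levi-Civita connection. Vector fields are sections of the complexified tangent bundle, and $g$, $\nabla$ and the Lie bracket are extended complex-linearly. All results are local: $M$ is replaced by a small open set on which there is a frame $\{e_i,\theta^j\}_{i,j=1}^n$ of the complexified tangent bundle with $g(e_i,e_j)=0$, $g(\theta^i,\theta^j)=0$, $g(e_i,\theta^j)=\frac12\delta_i^j$. Let $V=\mathrm{Span}\{e_i\}$, and identify $\mathrm{Span}\{\theta^j\}$ with the dual bundle $V^*$ via $\theta^j(e_i)=\delta^j_i$. The spinor bundle is $S=\wedge V^*$ with Clifford action $(e+\theta)\cdot\hat\varphi=e\lrcorner\hat\varphi+\theta\wedge\hat\varphi$ for $e\in V,\theta\in V^*$; thus $(vu+uv)\cdot\hat\varphi=2g(v,u)\hat\varphi$. A spinorial connection is a connection $\hat\nabla$ on $S$ satisfying the Leibniz rule $\hat\nabla_X(v\cdot\hat\varphi)=(\nabla_Xv)\cdot\hat\varphi+v\cdot\hat\nabla_X\hat\varphi$ for all vector fields $X,v$ and spinor fields $\hat\varphi$ (no compatibility with an inner product on $S$ is required). An isotropic distribution $I$ is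 a smooth constant-rank subbundle of the complexified tangent bundle with $g(v,v)=0$ for all $v\in I$. Its associated pure subspace is the subbundle $\hat L_I=\{\hat\varphi\in S: v\cdot\hat\varphi=0\ \forall v\in I\}$ of $S$. $I$ is integrable if it is closed under Lie brackets: $[X,Y]\in I$ for all vector fields $X,Y$ in $I$. For an integrable distribution $I$ (possibly complex), ''its leaves are totally geodesic submanifolds'' means that $\nabla_XY$ is in $I$ for all vector fields $X,Y$ in $I$ (for real distributions this is equivalent to every geodesic of $M$ tangent to a leaf at a point remaining in that leaf). *)

(* Defs.v *)
From mathcomp Require Import all_boot all_order all_algebra complex.
From mathcomp Require Import all_classical all_reals all_analysis.

Set Implicit Arguments.
Unset Strict Implicit.
Unset Printing Implicit Defensive.

Import Order.TTheory GRing.Theory Num.Theory numFieldNormedType.Exports.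

Local Open Scope classical_set_scope.
Local Open Scope ring_scope.
Local Open Scope complex_scope.

Definition iter_partial (R : realType) (m : nat) (s : seq 'I_m)
    (f : 'rV[R]_m -> R) : 'rV[R]_m -> R :=
  foldr (fun i h x => 'D_(delta_mx 0 i) h x) f s.

(* C^oo on U: all iterated partial derivatives exist and are continuous on U.
   Only meaningful for open U. *)
Definition smooth_in (R : realType) (m : nat) (U : set 'rV[R]_m)
    (f : 'rV[R]_m -> R) : Prop :=
  forall (s : seq 'I_m) (x : 'rV[R]_m), U x ->
    {for x, continuous (iter_partial s f)} /\
    (forall i : 'I_m, derivable (iter_partial s f) x (delta_mx 0 i)).

(* [cmap] and [cinv] are only meaningful on [cdom] and on its image. *)
Record chart (R : realType) (m : nat) (M : topologicalType) := Chart {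
  cdom : set M;
  cmap : M -> 'rV[R]_m;
  cinv : 'rV[R]_m -> M }.

Record is_chart (R : realType) (m : nat) (M : topologicalType)
    (c : chart R m M) : Prop := IsChart {
  chart_open : open (cdom c);
  chart_open_im : open (cmap c @` cdom c);
  chart_cancel : forall p, cdom c p -> cinv c (cmap c p) = p;
  chart_cont : {within cdom c, continuous (cmap c)};
  chart_cont_inv : {within cmap c @` cdom c, continuous (cinv c)} }.

Record manifold (R : realType) (m : nat) := Manifold {
  points :> topologicalType;
  atlas : set (chart R m points);
  manifold_hausdorff : hausdorff_space points;
  manifold_second_countable : @second_countable points;
  atlas_chart : forall c, atlas c -> is_chart c;
  atlas_cover : forall p : points, exists2 c, atlas c & cdom c p;
  atlas_compatible : forall c d, atlas c -> atlas d -> forall i : 'I_m,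
    smooth_in (cmap c @` (cdom c `&` cdom d))
      (fun x => cmap d (cinv c x) 0 i) }.

(* A tangent vector is the derivation v : f |-> v f; a complex tangent vector
   Re v + i Im v is the complex-valued derivation f |-> Re v f + i Im v f. *)
Definition tvec (R : realType) (m : nat) (M : manifold R m) : Type :=
  (M -> R) -> R.
Definition ctvec (R : realType) (m : nat) (M : manifold R m) : Type :=
  (M -> R) -> R[i].

Section Geometry.
Context {R : realType} {m : nat} {M : manifold R m}.

(* Only meaningful for open W. *)
Definition smooth_on (W : set M) (f : M -> R) : Prop :=
  forall c, atlas c -> smooth_in (cmap c @` (cdom c `&` W)) (f \o cinv c).

Definition csmooth_on (W : set M) (h : M -> R[i]) : Prop :=
  smooth_on W (fun p => complex.Re (h p)) /\
  smooth_on W (fun p => complex.Im (h p)).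

Definition smooth (f : M -> R) : Prop := smooth_on setT f.
Definition csmooth (h : M -> R[i]) : Prop := csmooth_on setT h.

(* Tangent vectors at p are derivations at p of the algebra of smooth
   functions; the third clause normalizes the (irrelevant) values on non-smooth
   functions, so that Leibniz equality is equality of derivations. *)
Record tangent (p : M) (v : tvec M) : Prop := Tangent {
  tangent_linear : forall (a : R) (f g : M -> R), smooth f -> smooth g ->
    v (fun q => a * f q + g q) = a * v f + v g;
  tangent_leibniz : forall f g : M -> R, smooth f -> smooth g ->
    v (fun q => f q * g q) = v f * g p + f p * v g;
  tangent_junk : forall f : M -> R, ~ smooth f -> v f = 0 }.

Definition vfield_on (W : set M) (X : M -> tvec M) : Prop :=
  (forall p, W p -> tangent p (X p)) /\
  (forall f, smooth f -> smooth_on W (fun p => X p f)).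

Definition vfield (X : M -> tvec M) : Prop := vfield_on setT X.

Definition lie_bracket (X Y : M -> tvec M) : M -> tvec M :=
  fun p f => X p (fun q => Y q f) - Y p (fun q => X q f).

Definition reV (v : ctvec M) : tvec M :=
  fun f => complex.Re (v f).
Definition imV (v : ctvec M) : tvec M :=
  fun f => complex.Im (v f).

Definition ctangent (p : M) (v : ctvec M) : Prop :=
  tangent p (reV v) /\ tangent p (imV v).

Definition cvfield_on (W : set M) (X : M -> ctvec M) : Prop :=
  vfield_on W (fun p => reV (X p)) /\ vfield_on W (fun p => imV (X p)).

Definition cvfield (X : M -> ctvec M) : Prop := cvfield_on setT X.

Definition cderiv (X : M -> ctvec M) (h : M -> R[i]) : M -> R[i] :=
  fun p => X p (fun q => complex.Re (h q)) +
    (0 +i* 1) * X p (fun q => complex.Im (h q)).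

(* Complex-bilinear extension of a (real-bilinear) operation on real fields;
   applied to the Lie bracket and to the Levi-Civita connection. *)
Definition cextend
    (B : (M -> tvec M) -> (M -> tvec M) -> M -> tvec M)
    (X Y : M -> ctvec M) : M -> ctvec M :=
  let X1 := fun p => reV (X p) in let X2 := fun p => imV (X p) in
  let Y1 := fun p => reV (Y p) in let Y2 := fun p => imV (Y p) in
  fun p f => (B X1 Y1 p f - B X2 Y2 p f) +i* (B X1 Y2 p f + B X2 Y1 p f).

Record is_metric (g : M -> tvec M -> tvec M -> R) : Prop :=
  IsMetric {
  metric_sym : forall p u v, tangent p u -> tangent p v -> g p u v = g p v u;
  metric_linear : forall p (a : R) u v w,
    tangent p u -> tangent p v -> tangent p w ->
    g p (fun f => a * u f + v f) w = a * g p u w + g p v w;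
  metric_nondegenerate : forall p u, tangent p u ->
    (forall v, tangent p v -> g p u v = 0) -> u = (fun=> 0);
  metric_smooth : forall X Y, vfield X -> vfield Y ->
    smooth (fun p => g p (X p) (Y p)) }.

Definition cmetric (g : M -> tvec M -> tvec M -> R)
    (p : M) (v w : ctvec M) : R[i] :=
  (g p (reV v) (reV w) - g p (imV v) (imV w)) +i*
  (g p (reV v) (imV w) + g p (imV v) (reV w)).

Record levi_civita (g : M -> tvec M -> tvec M -> R)
    (D : (M -> tvec M) -> (M -> tvec M) -> M -> tvec M) :
    Prop := LeviCivita {
  lc_vfield : forall X Y, vfield X -> vfield Y -> vfield (D X Y);
  lc_linear : forall h X Y Z, smooth h -> vfield X -> vfield Y -> vfield Z ->
    D (fun p f => h p * X p f + Y p f) Z =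
    (fun p f => h p * D X Z p f + D Y Z p f);
  lc_additive : forall X Y Z, vfield X -> vfield Y -> vfield Z ->
    D X (fun p f => Y p f + Z p f) = (fun p f => D X Y p f + D X Z p f);
  lc_leibniz : forall h X Y, smooth h -> vfield X -> vfield Y ->
    D X (fun p f => h p * Y p f) =
    (fun p f => X p h * Y p f + h p * D X Y p f);
  lc_torsion_free : forall X Y, vfield X -> vfield Y ->
    (fun p f => D X Y p f - D Y X p f) = lie_bracket X Y;
  lc_metric : forall X Y Z, vfield X -> vfield Y -> vfield Z -> forall p,
    X p (fun q => g q (Y q) (Z q)) =
    g p (D X Y p) (Z p) + g p (Y p) (D X Z p) }.

Definition frame_comb (n : nat) (e th : 'I_n -> M -> ctvec M) (p : M)
    (ab : 'rV[R[i]]_n * 'rV[R[i]]_n) : ctvec M :=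
  fun f => \sum_i ab.1 0 i * e i p f + \sum_j ab.2 0 j * th j p f.

Record is_null_frame (g : M -> tvec M -> tvec M -> R)
    (n : nat) (e th : 'I_n -> M -> ctvec M) : Prop := IsNullFrame {
  frame_e : forall i, cvfield (e i);
  frame_th : forall j, cvfield (th j);
  frame_basis : forall p v, ctangent p v ->
    exists! ab, v = frame_comb e th p ab;
  frame_ee : forall p i j, cmetric g p (e i p) (e j p) = 0;
  frame_thth : forall p i j, cmetric g p (th i p) (th j p) = 0;
  frame_eth : forall p i j,
    cmetric g p (e i p) (th j p) = if i == j then 2^-1 else 0 }.

Definition frame_coord (n : nat) (e th : 'I_n -> M -> ctvec M) (p : M)
    (v : ctvec M) : 'rV[R[i]]_n * 'rV[R[i]]_n :=
  xget 0 [set ab | v = frame_comb e th p ab].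

End Geometry.

(* The exterior algebra of V^*: the spinor s is the sum over T = {j1 < ... < jk}
   of s T times th^j1 /\ ... /\ th^jk. *)
Definition spinor (R : realType) (n : nat) := {ffun {set 'I_n} -> R[i]}.

Definition ext_sign (R : realType) (n : nat) (j : 'I_n) (T : {set 'I_n}) :
    R[i] :=
  (-1) ^+ #|[set k in T | (k < j)%N]|.

(* th^j /\ s *)
Definition wedge (R : realType) (n : nat) (j : 'I_n) (s : spinor R n) :
    spinor R n :=
  [ffun T : {set 'I_n} =>
    if j \in T then ext_sign R j T * s (T :\ j)%SET else 0].

(* e_i _| s, the antiderivation with e_i _| th^j = delta_ij *)
Definition contract (R : realType) (n : nat) (i : 'I_n) (s : spinor R n) :
    spinor R n :=
  [ffun T : {set 'I_n} =>
    if i \in T then 0 else ext_sign R i T * s (i |: T)%SET].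

Section SpinGeometry.
Context {R : realType} {m n : nat} {M : manifold R m}.

Definition clifford (e th : 'I_n -> M -> ctvec M) (p : M)
    (v : ctvec M) (s : spinor R n) : spinor R n :=
  let ab := frame_coord e th p v in
  \sum_i ab.1 0 i *: contract i s + \sum_j ab.2 0 j *: wedge j s.

Definition spinor_field (phi : M -> spinor R n) : Prop :=
  forall T, csmooth (fun p => phi p T).

Record spinorial_connection (e th : 'I_n -> M -> ctvec M)
    (D : (M -> tvec M) -> (M -> tvec M) -> M -> tvec M)
    (hD : (M -> ctvec M) -> (M -> spinor R n) -> M -> spinor R n) :
    Prop := SpinorialConnection {
  sc_field : forall X phi, cvfield X -> spinor_field phi ->
    spinor_field (hD X phi);
  sc_linear : forall h X Y phi, csmooth h -> cvfield X -> cvfield Y ->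
    spinor_field phi ->
    hD (fun p f => h p * X p f + Y p f) phi =
    (fun p => h p *: hD X phi p + hD Y phi p);
  sc_additive : forall X phi psi, cvfield X -> spinor_field phi ->
    spinor_field psi ->
    hD X (fun p => phi p + psi p) = (fun p => hD X phi p + hD X psi p);
  sc_leibniz : forall h X phi, csmooth h -> cvfield X -> spinor_field phi ->
    hD X (fun p => h p *: phi p) =
    (fun p => cderiv X h p *: phi p + h p *: hD X phi p);
  sc_clifford : forall X v phi, cvfield X -> cvfield v -> spinor_field phi ->
    hD X (fun p => clifford e th p (v p) (phi p)) =
    (fun p => clifford e th p (cextend D X v p) (phi p) +
              clifford e th p (v p) (hD X phi p)) }.

(* Smooth of constant rank k: near every point, I is spanned by k smooth,
   pointwise independent local vector fields. *)
Definition subbundle (I : M -> set (ctvec M)) : Prop :=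
  exists k : nat, forall p : M, exists W : set M,
    [/\ open W, W p &
        exists X : 'I_k -> M -> ctvec M,
          (forall i, cvfield_on W (X i)) /\
          (forall q, W q ->
            (forall a : 'I_k -> R[i],
               (fun f => \sum_i a i * X i q f) = (fun=> 0) ->
               forall i, a i = 0) /\
            I q = [set v | exists a : 'I_k -> R[i],
                             v = (fun f => \sum_i a i * X i q f)])].

Definition isotropic_distribution
    (g : M -> tvec M -> tvec M -> R)
    (I : M -> set (ctvec M)) : Prop :=
  subbundle I /\ (forall p v, I p v -> cmetric g p v v = 0).

Definition vfield_in (I : M -> set (ctvec M))
    (X : M -> ctvec M) : Prop :=
  cvfield X /\ (forall p, I p (X p)).

Definition integrable_distribution (I : M -> set (ctvec M)) : Prop :=
  forall X Y, vfield_in I X -> vfield_in I Y ->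
    vfield_in I (cextend lie_bracket X Y).

(* Geometrically meaningful (about leaves) when I is integrable. *)
Definition totally_geodesic
    (D : (M -> tvec M) -> (M -> tvec M) -> M -> tvec M)
    (I : M -> set (ctvec M)) : Prop :=
  forall X Y, vfield_in I X -> vfield_in I Y -> vfield_in I (cextend D X Y).

Definition pure_subspace (e th : 'I_n -> M -> ctvec M)
    (I : M -> set (ctvec M)) (p : M) : set (spinor R n) :=
  [set s | forall v, I p v -> clifford e th p v s = 0].

Definition spinor_field_in (L : M -> set (spinor R n))
    (phi : M -> spinor R n) : Prop :=
  spinor_field phi /\ (forall p, L p (phi p)).

End SpinGeometry.

(* Main.v *)
Require Import Defs.
From HB Require Import structures.
From mathcomp Require Import all_boot all_order all_algebra complex.
From mathcomp Require Import all_classical all_reals all_analysis.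
From mathcomp Require Import ring lra.

(** A pure spinor field phi and a field Y of I satisfy Y phi = 0, so the Leibniz
    rule gives (nabla_X Y) phi + Y (hnabla_X phi) = 0 for X in I.  If I is totally
    geodesic the first term vanishes, whence hnabla_X phi is annihilated by every
    Y in I, which by cutoff functions takes arbitrary values in I.  Conversely, if
    the second term vanishes then nabla_X Y annihilates every section of L_I.  With
    V_1, ..., V_k a frame of I near p, all the spinors V_1 ... V_k s are in L_I;
    and w V_1 ... V_k = 0 forces w into the span of the V_i, since otherwise
    successive graded commutators with vectors dual to w, V_1, ..., V_k would
    reduce the product to a non-zero scalar.  Integrability is automatic because
    nabla is torsion-free. *)

Set Implicit Arguments.
Unset Strict Implicit.
Unset Printing Implicit Defensive.

Import Order.TTheory GRing.Theory Num.Theory numFieldNormedType.Exports.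
(* The analysis library has another [contract], on extended reals. *)
Local Notation contract := Defs.contract.
Local Open Scope classical_set_scope.
Local Open Scope ring_scope.
Local Open Scope complex_scope.

(** * Smooth functions on open sets of coordinate space *)

Lemma is_derive_line (R : realType) (V : normedModType R) (f : V -> R)
    (x v : V) (a : R) :
  is_derive x v f a <-> is_derive (0 : R) 1 (fun t : R => f (t *: v + x)) a.
Proof.
have e : 'D_v f x = 'D_1 (fun t : R => f (t *: v + x)) 0.
  rewrite /derive; set g1 := fun h => h^-1 *: _; set g2 := fun h => h^-1 *: _.
  suff -> : g1 = g2 by [].
  by rewrite funeqE /g1 /g2 => h /=; rewrite addr0 scale0r add0r [_%:A]mulr1.
split=> -[df <-]; apply: DeriveDef => //; last exact/derivable1P.
by move/derivable1P: df.
Qed.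

(** Restricting to the line through [x] in direction [v] reduces this to the one-variable chain
    rule, so [f] only has to be derivable in that one direction. *)
Lemma is_derive_comp1 (R : realType) (V : normedModType R) (f : V -> R)
    (h : R -> R) (x v : V) (a b : R) :
  is_derive x v f a -> is_derive (f x) (1 : R) h b ->
  is_derive x v (h \o f) (b * a).
Proof.
move=> /is_derive_line dl dh; apply/is_derive_line.
apply: (is_derive1_comp (f := h)) dl.
by rewrite scale0r add0r.
Qed.

(** * The flat function exp(-1/t) and its relatives *)

Section Flat.
Context {R : realType}.

(* The factor [t ^- k] makes the family stable under derivation. *)
Definition flat (k : nat) (t : R) : R :=
  if 0 < t then t ^- k * expR (- t^-1) else 0.

Lemma flat_le0 k t : t <= 0 -> flat k t = 0.
Proof. by rewrite /flat ltNge => ->. Qed.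

Lemma flat_gt0 k t : 0 < t -> 0 < flat k t.
Proof. by move=> t0; rewrite /flat t0 mulr_gt0 ?expR_gt0// invr_gt0 exprn_gt0. Qed.

(** A single term of the exponential series bounds [t ^- k.+1] by a multiple of [expR t^-1]; one
    factor [t] is left over. The linear bound gives continuity at 0 by squeezing. *)
Lemma flat_bound k t : `|flat k t| <= k.+2`!%:R * `|t|.
Proof.
have [t0|t0] := leP t 0; first by rewrite flat_le0// normr0 mulr_ge0.
rewrite (gtr0_norm (flat_gt0 k t0)) (gtr0_norm t0) /flat t0 expRN.
have := @expR_ge1Dxn _ t^-1 k (ltW _); rewrite invr_gt0 => /(_ t0) h.
have h1 : t ^- k.+1 <= k.+2`!%:R * expR t^-1.
  have f1 : 0 < (k.+1`!)%:R :> R by rewrite ltr0n fact_gt0.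
  have : t ^- k.+1 / k.+1`!%:R <= expR t^-1.
    by apply: le_trans h; rewrite exprVn lerDr.
  rewrite ler_pdivrMr// mulrC => /le_trans; apply.
  by rewrite ler_wpM2r ?expR_ge0// ler_nat leq_pfact.
rewrite ler_pdivrMr ?expR_gt0//.
have -> : t ^- k = t * t ^- k.+1.
  by rewrite exprS invfM mulrA mulfV ?mul1r ?gt_eqF.
by rewrite mulrAC [leRHS]mulrC ler_wpM2l// ltW.
Qed.

Lemma flat_continuous0 k : {for 0, continuous (flat k)}.
Proof.
rewrite /prop_for /continuous_at flat_le0//.
have c0 : (k.+2`!%:R * `|t|) @[t --> (0:R)] --> (0:R).
  rewrite -[X in _ --> X](mulr0 (k.+2`!%:R)).
  apply: cvgM; first exact: cvg_cst.
  by rewrite -[X in _ --> X](@normr0 R R); apply: cvg_norm; exact: cvg_id.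
apply: (squeeze_cvgr (f := fun t => - (k.+2`!%:R * `|t|)) _ _ c0).
  by near=> t; rewrite -ler_norml flat_bound.
by rewrite -[X in _ --> X]oppr0; apply: cvgN.
Unshelve. all: by end_near. Qed.

(** Away from 0 this is the product rule, or the derivative of a locally constant function. The
    formula stays valid at 0, where its value is 0. *)
Lemma flat_is_derive (k : nat) (t : R) :
  is_derive t (1 : R) (flat k) (- k%:R * flat k.+1 t + flat k.+2 t).
Proof.
have [t0|t0|->] := ltgtP t 0.
- apply: (@near_eq_is_derive _ _ _ (cst 0)).
    near=> s; rewrite flat_le0//=.
    by apply: ltW; near: s; exact: lt_nbhsl.
  rewrite !flat_le0 ?ltW// mulr0 addr0; exact: is_derive_cst.
- apply: (@near_eq_is_derive _ _ _ (fun s : R => s ^- k * expR (- s^-1))).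
    near=> s; rewrite /flat ifT//.
    by near: s; exact: lt_nbhsr.
  have tn0 : t != 0 by rewrite gt_eqF.
  have dV : is_derive t (1 : R) (fun s : R => s^-1) (- t ^- 2).
    apply: DeriveDef; first exact: derivableV.
    by rewrite deriveV// derive_id /GRing.scale /= mulr1.
  have dX : is_derive t (1 : R) (fun s : R => s ^- k) (- k%:R * t ^- k.+1).
    have tk0 : t ^+ k != 0 by rewrite expf_neq0.
    have dp : derivable (fun s : R => s ^+ k) t 1.
      exact: exprn_derivable.
    apply: DeriveDef; first exact: derivableV.
    rewrite deriveV// exp_derive /GRing.scale /= mulr1.
    (* The power rule involves the truncated predecessor of [k], so [k = 0] is treated apart. *)
    case: k tk0 {dp} => [|k] tk0; first by rewrite !mulr0n !mul0r mulr0 oppr0 mul0r.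
    have tk0' : t ^+ k != 0 by rewrite expf_neq0.
    by rewrite /= expr2 !exprS; field; apply/andP.
  have dE : is_derive t (1 : R) (fun s : R => expR (- s^-1))
      (t ^- 2 * expR (- t^-1)).
    have := @is_derive1_comp _ expR (fun s : R => - s^-1) t _ _
      (is_derive_expR (- t^-1)) (is_deriveN dV).
    by rewrite opprK mulrC.
  apply: (is_derive_eq (is_deriveM dX dE)).
  rewrite /flat t0 /GRing.scale /=.
  by rewrite -!exprVn !exprS; ring.
- rewrite !flat_le0// mulr0 addr0.
  (* The difference quotient of [flat k] at 0 is [flat k.+1] itself, which tends to 0 by
     continuity. *)
  suff c : (fun h : R => h^-1 *: ((flat k \o shift 0) (h *: 1) - flat k 0))
      @ 0^' --> (0 : R).
    by apply: DeriveDef; [apply/cvg_ex; exists 0 | exact: cvg_lim].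
  have := @flat_continuous0 k.+1.
  rewrite /prop_for /continuous_at flat_le0// => c.
  have {}c : flat k.+1 @ (0 : R)^' --> (0 : R).
    by apply: cvg_trans c; apply: cvg_app; exact: nbhs_dnbhs.
  apply: cvg_trans c; apply: near_eq_cvg; near=> h.
  have h0 : h != 0 by near: h; exact: nbhs_dnbhs_neq.
  rewrite /= addr0 (@flat_le0 k 0)// subr0 /GRing.scale /= mulr1 /flat.
  case: ifP => _; last by rewrite mulr0.
  by rewrite exprSr invfM; ring.
Unshelve. all: by end_near. Qed.

End Flat.

(** * Closure properties of smooth functions of several variables *)

Section SmoothCalculus.
Context {R : realType} {m : nat}.
Implicit Types (U : set 'rV[R]_m) (f g : 'rV[R]_m -> R).

Lemma iter_partial_cons i s f :
  iter_partial (i :: s) f = 'D_(delta_mx 0 i) (iter_partial s f).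
Proof. by []. Qed.

Lemma iter_partial_rcons s i f :
  iter_partial (rcons s i) f = iter_partial s ('D_(delta_mx 0 i) f).
Proof. by rewrite /iter_partial foldr_rcons. Qed.

Lemma derive_eq_in U f g v : open U -> {in U, f =1 g} ->
  {in U, 'D_v f =1 'D_v g}.
Proof.
move=> oU fg x Ux; apply: near_eq_derive.
near=> y; apply: fg; rewrite inE; near: y.
by apply: open_nbhs_nbhs; split=> //; rewrite inE in Ux.
Unshelve. all: by end_near. Qed.

Lemma iter_partial_eq_in U f g s : open U -> {in U, f =1 g} ->
  {in U, iter_partial s f =1 iter_partial s g}.
Proof.
move=> oU fg; elim: s => [//|i s IH].
exact: derive_eq_in.
Qed.

Lemma smooth_in_ext U f g : open U -> {in U, f =1 g} ->
  smooth_in U f -> smooth_in U g.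
Proof.
move=> oU fg sf s x Ux.
have near_eq : {near x, iter_partial s f =1 iter_partial s g}.
  near=> y; apply: (iter_partial_eq_in s oU fg); rewrite inE; near: y.
  exact: open_nbhs_nbhs.
have [cf df] := sf s x Ux; split; last first.
  by move=> i; exact: near_eq_derivable (df i).
rewrite /prop_for /continuous_at -(nbhs_singleton near_eq).
exact: cvg_trans (near_eq_cvg near_eq) cf.
Unshelve. all: by end_near. Qed.

Lemma smooth_in_sub U V f : U `<=` V -> smooth_in V f -> smooth_in U f.
Proof. by move=> UV sf s x /UV; exact: sf. Qed.

Lemma smooth_in_local U f :
  (forall x, U x -> exists V, [/\ open V, V x & smooth_in V f]) ->
  smooth_in U f.
Proof. by move=> h s x /h[V [_ Vx]]; apply. Qed.

Lemma smooth_in_partial U f i : smooth_in U f ->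
  smooth_in U ('D_(delta_mx 0 i) f).
Proof.
by move=> sf s x Ux; rewrite -iter_partial_rcons; exact: sf.
Qed.

(** A coinduction principle: by induction on the list of directions, every iterated partial
    derivative agrees on [U] with a member of [P], and members of [P] are continuous and derivable
    there. It avoids explicit formulas for higher derivatives of products and compositions. *)
Lemma smooth_in_coind U (P : set ('rV[R]_m -> R)) : open U ->
  (forall f, P f -> forall x, U x -> {for x, continuous f}) ->
  (forall f, P f -> forall i, exists2 f', P f' &
     forall x, U x -> is_derive x (delta_mx 0 i) f (f' x)) ->
  forall f, P f -> smooth_in U f.
Proof.
move=> oU cP dP f Pf s.
have [g Pg fg] : exists2 g, P g & {in U, iter_partial s f =1 g}.
  elim: s => [|i s [g Pg fg]]; first by exists f.
  have [g' Pg' gg'] := dP g Pg i; exists g' => // x Ux.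
  rewrite iter_partial_cons (derive_eq_in _ oU fg)//.
  by apply: derive_val; apply: gg'; rewrite inE in Ux.
move=> x Ux; have near_eq : {near x, g =1 iter_partial s f}.
  near=> y; apply/esym/fg; rewrite inE; near: y.
  exact: open_nbhs_nbhs.
split=> [|i].
  rewrite /prop_for /continuous_at -(nbhs_singleton near_eq).
  exact: cvg_trans (near_eq_cvg near_eq) (cP g Pg x Ux).
have [g' _ gg'] := dP g Pg i.
by apply: near_eq_derivable near_eq _; have [] := gg' x Ux.
Unshelve. all: by end_near. Qed.

(** A class closed under partial derivation, to feed the coinduction principle. All the [flat k] are
    included at once because deriving one of them produces the next two. *)
Inductive smooth_closure U : set ('rV[R]_m -> R) :=
| SmoothBase f of smooth_in U f : smooth_closure U f
| SmoothCst a : smooth_closure U (fun=> a)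
| SmoothAdd f g of smooth_closure U f & smooth_closure U g :
    smooth_closure U (fun x => f x + g x)
| SmoothMul f g of smooth_closure U f & smooth_closure U g :
    smooth_closure U (fun x => f x * g x)
| SmoothFlat k f of smooth_closure U f :
    smooth_closure U (fun x => flat k (f x)).

Lemma flat_continuous k : continuous (flat k : R -> R).
Proof.
move=> t; have [dt _] := flat_is_derive k t.
exact/differentiable_continuous/derivable1_diffP.
Qed.

Lemma smooth_in_closure U f : open U -> smooth_closure U f -> smooth_in U f.
Proof.
move=> oU; apply: (smooth_in_coind oU) => {}f.
  elim=> [{}f sf|a|{}f g _ cf _ cg|{}f g _ cf _ cg|k {}f _ cf] x Ux.
  - by have [] := sf [::] x Ux.
  - exact: cst_continuous.
  - by apply: continuousD; [exact: cf|exact: cg].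
  - by apply: continuousM; [exact: cf|exact: cg].
  - by apply: continuous_comp; [exact: cf|exact: flat_continuous].
elim=> [{}f sf|a|{}f g _ df _ dg|{}f g Pf df Pg dg|k {}f Pf df] i.
- exists ('D_(delta_mx 0 i) f).
    exact/SmoothBase/smooth_in_partial.
  by move=> x Ux; apply/derivableP; have [_] := sf [::] x Ux; apply.
- exists (fun=> 0); first exact: SmoothCst.
  by move=> x Ux; exact: is_derive_cst.
- have [f' Pf' ff'] := df i; have [g' Pg' gg'] := dg i.
  exists (fun x => f' x + g' x); first exact: SmoothAdd.
  by move=> x Ux; apply: is_deriveD; [exact: ff'|exact: gg'].
- have [f' Pf' ff'] := df i; have [g' Pg' gg'] := dg i.
  exists (fun x => f x * g' x + g x * f' x).
    by apply: SmoothAdd; exact: SmoothMul.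
  by move=> x Ux; apply: is_deriveM; [exact: ff'|exact: gg'].
- have [f' Pf' ff'] := df i.
  exists (fun x => (- k%:R * flat k.+1 (f x) + flat k.+2 (f x)) * f' x).
    apply: SmoothMul => //; apply: SmoothAdd; last exact: SmoothFlat.
    by apply: SmoothMul; [exact: SmoothCst|exact: SmoothFlat].
  move=> x Ux; apply: (is_derive_comp1 (h := flat k)); first exact: ff'.
  exact: flat_is_derive.
Qed.

Lemma smooth_in_cst U a : open U -> smooth_in U (fun=> a).
Proof. by move=> oU; apply: smooth_in_closure => //; exact: SmoothCst. Qed.

Lemma smooth_inD U f g : open U -> smooth_in U f -> smooth_in U g ->
  smooth_in U (fun x => f x + g x).
Proof.
by move=> oU sf sg; apply: smooth_in_closure => //;
  apply: SmoothAdd; exact: SmoothBase.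
Qed.

Lemma smooth_inM U f g : open U -> smooth_in U f -> smooth_in U g ->
  smooth_in U (fun x => f x * g x).
Proof.
by move=> oU sf sg; apply: smooth_in_closure => //;
  apply: SmoothMul; exact: SmoothBase.
Qed.

(* [- 1 * _] instead of a subtraction: [smooth_closure] has no rule for
   opposites. *)
Definition bump_function (r : R) (x0 x : 'rV[R]_m) : R :=
  \prod_i (flat 0 (r + (x 0 i - x0 0 i)) * flat 0 (r + - 1 * (x 0 i - x0 0 i))).

Lemma bump_function_center r x0 : 0 < r -> bump_function r x0 x0 != 0.
Proof.
move=> r0; apply/prodf_neq0 => i _.
by rewrite subrr mulr0 addr0 mulf_neq0// gt_eqF// flat_gt0.
Qed.

Lemma bump_function_out r (x0 x : 'rV[R]_m) i : r < `|x 0 i - x0 0 i| ->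
  bump_function r x0 x = 0.
Proof.
rewrite lter_normr => h; apply/eqP/prodf_eq0; exists i => //.
case/orP: h => h; rewrite mulf_eq0; apply/orP; [right|left];
by rewrite flat_le0//; lra.
Qed.

(** The map [u] will be a change of charts: a bump built in one chart must be shown smooth in all
    the others. *)
Lemma smooth_in_bump U (u : 'rV[R]_m -> 'rV[R]_m) r x0 : open U ->
  (forall i, smooth_in U (fun x => u x 0 i)) ->
  smooth_in U (fun x => bump_function r x0 (u x)).
Proof.
move=> oU su; apply: smooth_in_closure => //; rewrite /bump_function.
elim: (index_enum _) => [|i s IH].
  by under eq_fun do rewrite big_nil; exact: SmoothCst.
under eq_fun do rewrite big_cons; apply: SmoothMul => //.
by apply: SmoothMul; apply: SmoothFlat; apply: SmoothAdd; do ?exact: SmoothCst;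
  do ?[apply: SmoothMul; first exact: SmoothCst];
  apply: SmoothAdd; do ?[exact: SmoothCst|exact: SmoothBase].
Qed.

End SmoothCalculus.

(** * Smooth functions and cutoffs on a manifold *)

Section SmoothFunctions.
Context {R : realType} {m : nat} {M : manifold R m}.
Implicit Types (W V : set M) (f g : M -> R) (c : chart R m M).

(** The image is the part of the open chart image that [cinv c] sends into [W], so continuity of
    [cinv c] makes it open. *)
Lemma chart_image_open c W : atlas c -> open W ->
  open (cmap c @` (cdom c `&` W)).
Proof.
move=> /atlas_chart[oc oi cK _ ci] oW.
have -> : cmap c @` (cdom c `&` W) =
    (cmap c @` cdom c) `&` cinv c @^-1` W.
  apply/seteqP; split=> [_ [q [cq Wq] <-]|_ [[q cq <-]]] /=.
    by split; [exists q|rewrite cK].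
  by rewrite cK// => Wq; exists q.
move: ci; rewrite continuous_open_subspace// => ci.
by have /(continuous_inP _ oi) := ci; apply.
Qed.

Lemma smooth_on_local W f :
  (forall p, W p -> exists V, [/\ open V, V p & smooth_on V f]) ->
  smooth_on W f.
Proof.
move=> h c ac; apply: smooth_in_local => _ [q [cq Wq] <-].
have [V [oV Vq sf]] := h q Wq; exists (cmap c @` (cdom c `&` V)); split.
- exact: chart_image_open.
- by exists q.
- exact: sf.
Qed.

Lemma smooth_on_sub V W f : V `<=` W -> smooth_on W f -> smooth_on V f.
Proof.
move=> VW sf c ac; apply: smooth_in_sub (sf c ac).
by apply: image_subset; exact: setIS.
Qed.

Lemma smooth_on_ext W f g : open W -> (forall q, W q -> f q = g q) ->
  smooth_on W f -> smooth_on W g.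
Proof.
move=> oW fg sf c ac; apply: smooth_in_ext (sf c ac).
  exact: chart_image_open.
move=> x; rewrite inE => -[q [cq Wq] <-] /=.
by have [_ _ -> // _ _] := atlas_chart ac; exact: fg.
Qed.

Lemma smooth_on_cst W a : open W -> smooth_on W (fun=> a).
Proof. by move=> oW c ac; apply: smooth_in_cst; exact: chart_image_open. Qed.

Lemma smooth_onD W f g : open W -> smooth_on W f -> smooth_on W g ->
  smooth_on W (fun p => f p + g p).
Proof.
move=> oW sf sg c ac; apply: smooth_inD; [|exact: sf|exact: sg].
exact: chart_image_open.
Qed.

Lemma smooth_onM W f g : open W -> smooth_on W f -> smooth_on W g ->
  smooth_on W (fun p => f p * g p).
Proof.
move=> oW sf sg c ac; apply: smooth_inM; [|exact: sf|exact: sg].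
exact: chart_image_open.
Qed.

(** The closed set [K] bounds the support inside [W]. Vanishing outside [W] alone would not make
    extensions by zero smooth at the boundary of [W]. *)
Definition cutoff W (b : M -> R) : Prop :=
  smooth b /\ exists K, [/\ closed K, K `<=` W & forall q, ~ K q -> b q = 0].

Lemma cutoff_out W b q : cutoff W b -> ~ W q -> b q = 0.
Proof. by move=> [_ [K [_ KW bK]]] nWq; apply: bK => /KW. Qed.

(** The open sets [W] and the complement of [K] cover the manifold, and the product is zero on the
    second. *)
Lemma smooth_cutoff W b f : open W -> cutoff W b -> smooth_on W f ->
  smooth (fun q => b q * f q).
Proof.
move=> oW [sb [K [cK KW bK]]] sf; apply: smooth_on_local => q _.
have [Wq|nWq] := pselect (W q).
  exists W; split; [exact: oW|exact: Wq|].
  exact: smooth_onM oW (smooth_on_sub (@subsetT _ W) sb) sf.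
exists (~` K); split; [exact: closed_openC|by move=> /KW|].
apply: (@smooth_on_ext _ (fun=> 0)); first exact: closed_openC.
  by move=> p /bK ->; rewrite mul0r.
by apply: smooth_on_cst; exact: closed_openC.
Qed.

Lemma exists_cutoff p W : open W -> W p -> exists2 b, cutoff W b & b p != 0.
Proof.
move=> oW Wp; have [c ac cp] := atlas_cover p.
have [oc oi cK _ ci] := atlas_chart ac.
pose x0 := cmap c p; pose U := cmap c @` (cdom c `&` W).
have Ux0 : U x0 by exists p.
have /nbhs_ballP[e /= e0 eU] : nbhs x0 U.
  by apply: open_nbhs_nbhs; split=> //; exact: chart_image_open.
(* The closed cube of half-side [e / 2]: it lies in the ball of radius [e], it is compact, and the
   bump function vanishes outside it. *)
pose B := [set y : 'rV[R]_m | forall i,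
  (`[x0 0 i - e / 2, x0 0 i + e / 2]%classic : set R) (y ord0 i)].
have BU : B `<=` U.
  move=> y By; apply: eU; split=> // i j; rewrite ord1 /ball /= distrC.
  have := By j; rewrite /= in_itv /= -ler_distl => /le_lt_trans; apply.
  by rewrite ltr_pdivrMr// ltr_pMr// ltr1n.
have cB : compact B.
  apply: (@rV_compact _ _ (fun i => `[x0 0 i - e / 2, x0 0 i + e / 2]%classic)).
  by move=> i; exact: segment_compact.
pose K := cinv c @` B.
(* Here the Hausdorff property enters: [K] is compact, hence closed in the whole manifold and not
   only in the chart domain. *)
have cK' : closed K.
  apply: compact_closed; first exact: manifold_hausdorff.
  apply: continuous_compact cB; apply: continuous_subspaceW ci.
  by move=> y /BU[q [cq _] <-]; exists q.
have KW : K `<=` W by move=> _ [y /BU[q [cq Wq] <-] <-]; rewrite cK.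
pose b q := if q \in cdom c then bump_function (e / 2) x0 (cmap c q) else 0.
have bK q : ~ K q -> b q = 0.
  move=> nK; rewrite /b; case: ifPn => //; rewrite inE => cq.
  apply: contrapT => b0; apply: nK; exists (cmap c q); last exact: cK.
  move=> i; rewrite /= in_itv /= -ler_distl leNgt.
  by apply/negP => /bump_function_out.
exists b; last by rewrite /b ifT ?inE// bump_function_center// divr_gt0.
split; last by exists K.
apply: smooth_on_local => q _; have [cq|ncq] := pselect (cdom c q); last first.
  exists (~` K); split; first exact: closed_openC.
    by move=> [y /BU[q' [cq' _] <-]]; rewrite cK// => qq'; rewrite qq' in cq'.
  apply: (@smooth_on_ext _ (fun=> 0)); first exact: closed_openC.
    by move=> r /bK ->.
  by apply: smooth_on_cst; exact: closed_openC.
exists (cdom c); split=> //.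
apply: (@smooth_on_ext _ (fun q => bump_function (e / 2) x0 (cmap c q))) => //.
  by move=> r cr; rewrite /b ifT// inE.
(* Read in another chart [d], the function is the bump composed with the transition map from [d] to
   [c]. *)
move=> d ad; apply: (@smooth_in_bump _ _ _ (fun y => cmap c (cinv d y))).
  exact: chart_image_open.
by move=> i; exact: atlas_compatible.
Qed.

Lemma cReD (x y : R[i]) : complex.Re (x + y) = complex.Re x + complex.Re y.
Proof. by case: x y => a b [c d]. Qed.

Lemma cImD (x y : R[i]) : complex.Im (x + y) = complex.Im x + complex.Im y.
Proof. by case: x y => a b [c d]. Qed.

(** The factor [- 1] replaces a subtraction so that the closure lemmas for sums, products and
    constants apply. *)
Lemma cReM (x y : R[i]) : complex.Re (x * y) =
  complex.Re x * complex.Re y + (- 1) * (complex.Im x * complex.Im y).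
Proof. by case: x y => a b [c d] /=; rewrite mulN1r. Qed.

Lemma cImM (x y : R[i]) : complex.Im (x * y) =
  complex.Re x * complex.Im y + complex.Im x * complex.Re y.
Proof. by case: x y => a b [c d]. Qed.

Lemma csmooth_on_cst W a : open W -> csmooth_on W (fun=> a).
Proof. by move=> oW; split; exact: smooth_on_cst. Qed.

Lemma csmooth_onD W (h k : M -> R[i]) : open W -> csmooth_on W h ->
  csmooth_on W k -> csmooth_on W (fun p => h p + k p).
Proof.
move=> oW [h1 h2] [k1 k2]; split.
  by under eq_fun do rewrite cReD; exact: smooth_onD oW h1 k1.
by under eq_fun do rewrite cImD; exact: smooth_onD oW h2 k2.
Qed.

Lemma csmooth_onM W (h k : M -> R[i]) : open W -> csmooth_on W h ->
  csmooth_on W k -> csmooth_on W (fun p => h p * k p).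
Proof.
move=> oW [h1 h2] [k1 k2]; split.
  under eq_fun do rewrite cReM.
  apply: (smooth_onD oW (smooth_onM oW h1 k1)).
  exact: smooth_onM oW (smooth_on_cst _ oW) (smooth_onM oW h2 k2).
under eq_fun do rewrite cImM.
exact: smooth_onD oW (smooth_onM oW h1 k2) (smooth_onM oW h2 k1).
Qed.

Lemma csmooth_on_sum W (J : Type) (s : seq J) (h : J -> M -> R[i]) : open W ->
  (forall j, csmooth_on W (h j)) -> csmooth_on W (fun p => \sum_(j <- s) h j p).
Proof.
move=> oW sh; elim: s => [|j s IH].
  by under eq_fun do rewrite big_nil; exact: csmooth_on_cst.
under eq_fun do rewrite big_cons; exact: csmooth_onD oW (sh j) IH.
Qed.

End SmoothFunctions.

(** * Vector fields and subbundles *)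

Section VectorFields.
Context {R : realType} {m : nat} {M : manifold R m}.
Implicit Types (W : set M) (X Y : M -> tvec M).

Lemma tangent0 p : @tangent R m M p (fun=> 0).
Proof. by split=> *; rewrite ?mulr0 ?mul0r ?addr0. Qed.

Lemma tangent_comb p (a : R) (u v : tvec M) : tangent p u -> tangent p v ->
  tangent p (fun f => a * u f + v f).
Proof.
move=> [ul um uj] [vl vm vj]; split=> [b f g sf sg|f g sf sg|f nf].
- by rewrite ul// vl//; ring.
- by rewrite um// vm//; ring.
- by rewrite uj// vj// mulr0 addr0.
Qed.

Lemma vfield_on0 W : open W -> vfield_on W (fun=> (fun=> 0) : tvec M).
Proof.
by move=> oW; split=> [p _|f _]; [exact: tangent0|exact: smooth_on_cst].
Qed.

Lemma vfield_on_comb W (h : M -> R) X Y : open W -> smooth_on W h ->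
  vfield_on W X -> vfield_on W Y ->
  vfield_on W (fun p f => h p * X p f + Y p f).
Proof.
move=> oW sh [tX sX] [tY sY]; split=> [p Wp|f sf].
  exact: tangent_comb (tX p Wp) (tY p Wp).
exact: smooth_onD oW (smooth_onM oW sh (sX f sf)) (sY f sf).
Qed.

(** Outside [W] the values of [X] need not be tangent vectors, but there the product is the zero
    derivation. *)
Lemma vfield_cutoff W b X : open W -> cutoff W b -> vfield_on W X ->
  vfield (fun p f => b p * X p f).
Proof.
move=> oW cb [tX sX]; split=> [p _|f sf]; last first.
  exact: (smooth_cutoff oW cb (sX f sf)).
have [Wp|nWp] := pselect (W p).
  have := tangent_comb (b p) (tX p Wp) (tangent0 p).
  by under eq_fun do rewrite addr0.
under eq_fun do rewrite (cutoff_out cb nWp) mul0r; exact: tangent0.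
Qed.

Implicit Types (Z T : M -> ctvec M).

(** The nesting presents the real part as two successive real combinations, the shape handled by
    [tangent_comb] and [vfield_on_comb]. *)
Lemma reV_comb (z : R[i]) (u v : ctvec M) :
  reV (fun f => z * u f + v f) =
  (fun f => complex.Re z * reV u f + (- complex.Im z * imV u f + reV v f)).
Proof.
by apply/funext => f; rewrite /reV /imV cReD cReM mulN1r mulNr addrA.
Qed.

Lemma imV_comb (z : R[i]) (u v : ctvec M) :
  imV (fun f => z * u f + v f) =
  (fun f => complex.Re z * imV u f + (complex.Im z * reV u f + imV v f)).
Proof. by apply/funext => f; rewrite /reV /imV cImD cImM addrA. Qed.

Lemma ctangent0 p : @ctangent R m M p (fun=> 0).
Proof. by split; exact: tangent0. Qed.

Lemma ctangent_comb p (z : R[i]) (u v : ctvec M) :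
  ctangent p u -> ctangent p v -> ctangent p (fun f => z * u f + v f).
Proof.
move=> [u1 u2] [v1 v2]; split; [rewrite reV_comb|rewrite imV_comb].
  exact: tangent_comb u1 (tangent_comb _ u2 v1).
exact: tangent_comb u2 (tangent_comb _ u1 v2).
Qed.

Lemma ctangent_sum p (J : Type) (s : seq J) (a : J -> R[i])
    (v : J -> ctvec M) : (forall j, ctangent p (v j)) ->
  ctangent p (fun f => \sum_(j <- s) a j * v j f).
Proof.
move=> tv; elim: s => [|j s IH].
  by under eq_fun do rewrite big_nil; exact: ctangent0.
by under eq_fun do rewrite big_cons; exact: ctangent_comb.
Qed.

Lemma cvfield_on_ctangent W Z p : cvfield_on W Z -> W p -> ctangent p (Z p).
Proof. by move=> [[t1 _] [t2 _]] Wp; split; [exact: t1|exact: t2]. Qed.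

Lemma cvfield_ctangent Z p : cvfield Z -> ctangent p (Z p).
Proof. by move/cvfield_on_ctangent; apply. Qed.

Lemma cvfield_on_comb W (h : M -> R[i]) Z T : open W -> csmooth_on W h ->
  cvfield_on W Z -> cvfield_on W T ->
  cvfield_on W (fun p f => h p * Z p f + T p f).
Proof.
move=> oW [h1 h2] [Z1 Z2] [T1 T2]; split.
  under eq_fun do rewrite reV_comb.
  apply: (vfield_on_comb oW h1 Z1 (vfield_on_comb oW _ Z2 T1)).
  under eq_fun do rewrite -mulN1r.
  exact: smooth_onM oW (smooth_on_cst _ oW) h2.
under eq_fun do rewrite imV_comb.
exact: vfield_on_comb oW h1 Z2 (vfield_on_comb oW h2 Z1 T2).
Qed.

Lemma cvfield_sum (J : Type) (s : seq J) (h : J -> M -> R[i])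
    (Z : J -> M -> ctvec M) :
  (forall j, csmooth (h j)) -> (forall j, cvfield (Z j)) ->
  cvfield (fun p f => \sum_(j <- s) h j p * Z j p f).
Proof.
move=> sh vZ; elim: s => [|j s IH].
  under eq_fun do under eq_fun do rewrite big_nil.
  by split; apply: vfield_on0; exact: openT.
under eq_fun do under eq_fun do rewrite big_cons.
exact: cvfield_on_comb openT (sh j) (vZ j) IH.
Qed.

Lemma cvfield_cutoff W b Z : open W -> cutoff W b -> cvfield_on W Z ->
  cvfield (fun p f => (b p)%:C * Z p f).
Proof.
move=> oW cb [Z1 Z2]; split.
  rewrite (_ : (fun p => _) = (fun p f => b p * reV (Z p) f)).
    exact: vfield_cutoff oW cb Z1.
  by apply/funext => p; apply/funext => f; rewrite /reV cReM /= mul0r mulr0 addr0.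
rewrite (_ : (fun p => _) = (fun p f => b p * imV (Z p) f)).
  exact: vfield_cutoff oW cb Z2.
by apply/funext => p; apply/funext => f; rewrite /imV cImM /= mul0r addr0.
Qed.

Lemma subbundle0 (I : M -> set (ctvec M)) p : subbundle I -> I p (fun=> 0).
Proof.
move=> [k /(_ p)[W [oW Wp [X [vX /(_ p Wp)[_ ->]]]]]].
by exists (fun=> 0); apply/funext => f; rewrite big1// => i _; rewrite mul0r.
Qed.

(* A global substitute for a local frame of [I]: it spans [I] wherever the
   cutoff [b] does not vanish. *)
Lemma subbundle_frame (I : M -> set (ctvec M)) p : subbundle I ->
  exists (k : nat) (b : M -> R) (V : 'I_k -> M -> ctvec M),
  [/\ smooth b, b p != 0, forall i, vfield_in I (V i) &
    forall q, b q != 0 ->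
      (forall a : 'I_k -> R[i], (fun f => \sum_i a i * V i q f) = (fun=> 0) ->
        forall i, a i = 0) /\
      (forall v, I q v -> exists a : 'I_k -> R[i],
        v = (fun f => \sum_i a i * V i q f))].
Proof.
move=> sI; have [k /(_ p)[W [oW Wp [X [vX spanX]]]]] := sI.
have [b cb bp] := exists_cutoff oW Wp.
(* The local frame times the cutoff, extended by zero. Where [b] is non-zero, coefficients in the
   two families differ by the invertible factor [b q]. *)
exists k, b, (fun i q f => (b q)%:C * X i q f); split=> //.
- by case: cb.
- move=> i; split; first exact: cvfield_cutoff oW cb (vX i).
  move=> q; have [Wq|nWq] := pselect (W q); last first.
    by under eq_fun do rewrite (cutoff_out cb nWq) mul0r; exact: subbundle0.
  have [_ ->] := spanX q Wq; exists (fun j => (b q)%:C *+ (j == i)).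
  apply/funext => f; rewrite (bigD1 i)//= eqxx big1 ?addr0// => j /negbTE ->.
  by rewrite mul0r.
- move=> q bq; have Wq : W q by apply: contrapT => /(cutoff_out cb)/eqP; exact/negP.
  have bq' : (b q)%:C != 0 :> R[i] by rewrite fmorph_eq0.
  have [fX IX] := spanX q Wq; split.
    move=> a a0 i; apply: (mulIf bq'); rewrite mul0r.
    apply: (fX (fun i => a i * (b q)%:C)); rewrite -a0.
    by apply/funext => f; apply: eq_bigr => j _; rewrite mulrA.
  move=> v; rewrite IX => -[a ->]; exists (fun i => a i / (b q)%:C).
  by apply/funext => f; apply: eq_bigr => j _; rewrite mulrA divfK.
Qed.

Lemma subbundle_comb (I : M -> set (ctvec M)) p (z : R[i]) (u v : ctvec M) :
  subbundle I -> I p u -> I p v -> I p (fun f => z * u f + v f).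
Proof.
move=> [k /(_ p)[W [oW Wp [X [vX /(_ p Wp)[_ ->]]]]]] [a ->] [a' ->].
exists (fun i => z * a i + a' i); apply/funext => f.
by rewrite mulr_sumr -big_split; apply: eq_bigr => i _ /=; ring.
Qed.

Lemma subbundle_sum (I : M -> set (ctvec M)) p (J : Type) (s : seq J)
    (a : J -> R[i]) (v : J -> ctvec M) : subbundle I ->
  (forall j, I p (v j)) -> I p (fun f => \sum_(j <- s) a j * v j f).
Proof.
move=> sI Iv; elim: s => [|j s IH].
  by under eq_fun do rewrite big_nil; exact: subbundle0.
by under eq_fun do rewrite big_cons; exact: subbundle_comb.
Qed.

Lemma subbundle_ctangent (I : M -> set (ctvec M)) p (v : ctvec M) :
  subbundle I -> I p v -> ctangent p v.
Proof.
move=> [k /(_ p)[W [oW Wp [X [vX /(_ p Wp)[_ ->]]]]]] [a ->].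
by apply: ctangent_sum => i; exact: cvfield_on_ctangent (vX i) Wp.
Qed.

(** Constant coefficients in the cut-off frame suffice, since that frame spans [I] at [p]. This
    passes from conditions on global fields to conditions at a point. *)
Lemma subbundle_extend (I : M -> set (ctvec M)) p (v : ctvec M) :
  subbundle I -> I p v -> exists2 V, vfield_in I V & V p = v.
Proof.
move=> sI Iv; have [k [b [V [_ bp VI /(_ p bp)[_ /(_ v Iv)[a ->]]]]]] :=
  subbundle_frame p sI.
exists (fun q f => \sum_i a i * V i q f) => //; split.
  apply: (@cvfield_sum _ _ (fun i => fun=> a i)) => i; last by have [] := VI i.
  by apply: csmooth_on_cst; exact: openT.
by move=> q; apply: subbundle_sum => // i; have [_] := VI i.
Qed.

End VectorFields.

(** * The Clifford action *)

Section ExteriorAlgebra.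
Context {R : realType} {n : nat}.
Implicit Types (s t : spinor R n) (T : {set 'I_n}).

Fact contract_is_linear (i : 'I_n) : linear (@contract R n i).
Proof.
move=> a s t; apply/ffunP => T; rewrite !ffunE.
by case: ifP => _; rewrite /GRing.scale /= ?mulr0 ?addr0// mulrDr mulrCA.
Qed.

HB.instance Definition _ i := GRing.isLinear.Build R[i] (spinor R n)
  (spinor R n) _ (@contract R n i) (contract_is_linear i).

Fact wedge_is_linear (i : 'I_n) : linear (@wedge R n i).
Proof.
move=> a s t; apply/ffunP => T; rewrite !ffunE.
by case: ifP => _; rewrite /GRing.scale /= ?mulr0 ?addr0// mulrDr mulrCA.
Qed.

HB.instance Definition _ i := GRing.isLinear.Build R[i] (spinor R n)
  (spinor R n) _ (@wedge R n i) (wedge_is_linear i).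

Lemma ext_signU1 (i j : 'I_n) T : i \notin T ->
  ext_sign R j (i |: T)%SET = (-1) ^+ (i < j)%N * ext_sign R j T.
Proof.
move=> iT; rewrite /ext_sign -exprD; congr (_ ^+ _).
case: ltnP => ij; last first.
  by apply: eq_card => k; rewrite !inE; case: eqVneq => [->|]//=;
    rewrite ltnNge ij andbF.
have -> : [set k in i |: T | (k < j)%N]%SET = (i |: [set k in T | (k < j)%N])%SET.
  by apply/finset.setP => k; rewrite !inE; case: eqVneq => [->|]//=.
by rewrite cardsU1 inE negb_and iT.
Qed.

Lemma ext_signD1 (i j : 'I_n) T : i \in T ->
  ext_sign R j (T :\ i)%SET = (-1) ^+ (i < j)%N * ext_sign R j T.
Proof.
move=> iT; rewrite -[in RHS](finset.setD1K iT) ext_signU1 ?inE ?eqxx//.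
by rewrite mulrA -expr2 sqrr_sign mul1r.
Qed.

(** Exactly one of [i < j] and [j < i] holds; this is the source of the minus sign in all the
    anticommutation relations below. *)
Lemma sign_lt_swap (i j : 'I_n) : i != j ->
  (-1) ^+ (j < i)%N = - (-1) ^+ (i < j)%N :> R[i].
Proof.
move=> ij; case: (ltngtP i j) => [||/val_inj e]; rewrite ?expr0 ?expr1 ?opprK//.
by rewrite e eqxx in ij.
Qed.

Lemma contract_contract (i j : 'I_n) s :
  contract i (contract j s) = - contract j (contract i s).
Proof.
apply/ffunP => T; rewrite !ffunE; have [->|ij] := eqVneq i j.
  by case: ifP; rewrite ?oppr0// finset.setU11 !mulr0 oppr0.
rewrite !inE (eq_sym j i) (negbTE ij) /=.
case: ifPn => iT; case: ifPn => jT; rewrite ?mulr0 ?oppr0//.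
rewrite !ext_signU1// (sign_lt_swap ij) finset.setUCA; ring.
Qed.

Lemma wedge_wedge (i j : 'I_n) s : wedge i (wedge j s) = - wedge j (wedge i s).
Proof.
apply/ffunP => T; rewrite !ffunE; have [->|ij] := eqVneq i j.
  by case: ifP; rewrite ?oppr0// finset.setD11 !mulr0 oppr0.
rewrite !inE (eq_sym j i) ij /=.
case: ifPn => iT; case: ifPn => jT; rewrite ?mulr0 ?oppr0//.
rewrite !ext_signD1// (sign_lt_swap ij).
by rewrite finset.setDDl finset.setUC -finset.setDDl; ring.
Qed.

(** On the diagonal, whether [i] belongs to [T] decides which of the two composites reproduces the
    coefficient of [s] at [T]; the other is zero there. Off the diagonal only a sign changes. *)
Lemma contract_wedge (i j : 'I_n) s : contract i (wedge j s) =
  (i == j)%:R *: s - wedge j (contract i s).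
Proof.
apply/ffunP => T; rewrite !ffunE /= !inE; have [<-|ij] := eqVneq i j.
  rewrite scale1r /=; case: ifPn => iT.
    rewrite finset.setD1K// mulrA ext_signD1// ltnn mul1r -expr2 sqrr_sign mul1r.
    by rewrite subrr.
  rewrite oppr0 addr0 ext_signU1// ltnn mul1r mulrA -expr2 sqrr_sign mul1r.
  by rewrite finset.setU1K.
rewrite scale0r add0r /=.
case: ifPn => iT; case: ifPn => jT; rewrite ?mulr0 ?oppr0//.
rewrite ext_signU1// ext_signD1// (sign_lt_swap ij).
suff -> : ((i |: T) :\ j)%SET = (i |: T :\ j)%SET by ring.
by apply/finset.setP => k; rewrite !inE; case: (eqVneq k i) => // ->; rewrite ij.
Qed.

(** Bundled as linear maps, so that they can instantiate the abstract operators [c] and [w] of the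
    next section. *)
Definition contract_lin i : {linear spinor R n -> spinor R n} := contract i.

Definition wedge_lin i : {linear spinor R n -> spinor R n} := wedge i.

Lemma contract_lin_anticomm i j s :
  contract_lin i (contract_lin j s) = - contract_lin j (contract_lin i s).
Proof. exact: contract_contract. Qed.

Lemma wedge_lin_anticomm i j s :
  wedge_lin i (wedge_lin j s) = - wedge_lin j (wedge_lin i s).
Proof. exact: wedge_wedge. Qed.

Lemma contract_wedge_lin i j s : contract_lin i (wedge_lin j s) =
  (i == j)%:R *: s - wedge_lin j (contract_lin i s).
Proof. exact: contract_wedge. Qed.

End ExteriorAlgebra.

(** * Clifford products derived from the anticommutation relations alone *)

Section HyperbolicAction.
Context {K : numFieldType} {V : lmodType K} {n : nat}.
Context (c w : 'I_n -> {linear V -> V}).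
Context (cc : forall i j s, c i (c j s) = - c j (c i s)).
Context (ww : forall i j s, w i (w j s) = - w j (w i s)).
Context (cw : forall i j s, c i (w j s) = (i == j)%:R *: s - w j (c i s)).
Implicit Types (x y u : 'rV[K]_n * 'rV[K]_n) (s t : V).

Definition cliff x s : V :=
  \sum_i x.1 0 i *: c i s + \sum_j x.2 0 j *: w j s.

Lemma cliff_combl (a : K) x y s :
  cliff (a *: x + y) s = a *: cliff x s + cliff y s.
Proof.
rewrite /cliff scalerDr addrACA !scaler_sumr; congr (_ + _);
by rewrite -big_split; apply: eq_bigr => i _; rewrite !mxE scalerDl scalerA.
Qed.

Lemma cliff_suml k (a : 'I_k -> K) (x : 'I_k -> 'rV[K]_n * 'rV[K]_n) s :
  cliff (\sum_i a i *: x i) s = \sum_i a i *: cliff (x i) s.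
Proof.
elim: (index_enum _) => [|i r IH]; last by rewrite !big_cons cliff_combl IH.
by rewrite !big_nil /cliff !big1 ?addr0// => i _; rewrite mxE scale0r.
Qed.

Lemma cliffZ x (a : K) s : cliff x (a *: s) = a *: cliff x s.
Proof.
rewrite /cliff scalerDr !scaler_sumr; congr (_ + _);
by apply: eq_bigr => i _; rewrite linearZ !scalerA mulrC.
Qed.

Lemma cliff0 x : cliff x 0 = 0.
Proof. by have := cliffZ x 0 0; rewrite !scale0r. Qed.

(** In null-frame coordinates this is twice the metric, because [e i] and [th i] pair to one half:
    it is the scalar by which the anticommutator of two vectors acts. *)
Definition hyp_form x y : K := \sum_i (x.1 0 i * y.2 0 i + x.2 0 i * y.1 0 i).

Let cc_sum x y s := \sum_i \sum_j (x.1 0 i * y.1 0 j) *: c i (c j s).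
Let cw_sum x y s := \sum_i \sum_j (x.1 0 i * y.2 0 j) *: c i (w j s).
Let wc_sum x y s := \sum_i \sum_j (x.2 0 i * y.1 0 j) *: w i (c j s).
Let ww_sum x y s := \sum_i \sum_j (x.2 0 i * y.2 0 j) *: w i (w j s).

Let cliff_cliff x y s : cliff x (cliff y s) =
  cc_sum x y s + cw_sum x y s + (wc_sum x y s + ww_sum x y s).
Proof.
rewrite [LHS]/cliff; congr (_ + _); rewrite -big_split; apply: eq_bigr => i _ /=;
rewrite /cliff linearD !linear_sum scalerDr !scaler_sumr; congr (_ + _);
by apply: eq_bigr => j _; rewrite linearZ scalerA.
Qed.

Let cc_sumC x y s : cc_sum x y s = - cc_sum y x s.
Proof.
rewrite /cc_sum exchange_big -sumrN; apply: eq_bigr => i _; rewrite -sumrN.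
by apply: eq_bigr => j _; rewrite cc scalerN mulrC.
Qed.

Let ww_sumC x y s : ww_sum x y s = - ww_sum y x s.
Proof.
rewrite /ww_sum exchange_big -sumrN; apply: eq_bigr => i _; rewrite -sumrN.
by apply: eq_bigr => j _; rewrite ww scalerN mulrC.
Qed.

Let cw_sumC x y s :
  cw_sum x y s = (\sum_i x.1 0 i * y.2 0 i) *: s - wc_sum y x s.
Proof.
rewrite /cw_sum /wc_sum [X in _ - X]exchange_big scaler_suml -sumrB.
apply: eq_bigr => i _.
rewrite (bigD1 i)//= [X in _ - X](bigD1 i)//= cw eqxx scale1r scalerBr opprD.
rewrite mulrC -!addrA; congr (_ + (_ + _)).
rewrite -sumrN; apply: eq_bigr => j; rewrite eq_sym => /negbTE ij.
by rewrite cw ij scale0r sub0r scalerN mulrC.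
Qed.

Lemma cliff_anticomm x y s :
  cliff x (cliff y s) = hyp_form x y *: s - cliff y (cliff x s).
Proof.
rewrite !cliff_cliff (cw_sumC x y) (cw_sumC y x) (cc_sumC x y) (ww_sumC x y).
rewrite /hyp_form big_split /= scalerDl.
under [X in _ = _ + X *: _ - _]eq_bigr do rewrite mulrC.
(* The permutation brings together the second and fourth summands, opposite multiples of [s], which
   then cancel. *)
rewrite !opprD opprK [RHS](AC (2*((1*2)*2)) ((2*4)*(3*(1*6))*(5*7))).
by rewrite /= subrr add0r.
Qed.

Definition cliff_prod (xs : seq ('rV[K]_n * 'rV[K]_n)) s : V := foldr cliff s xs.

Lemma cliff_prod_anticomm u xs s : {in xs, forall x, hyp_form u x = 0} ->
  cliff u (cliff_prod xs s) = (-1) ^+ size xs *: cliff_prod xs (cliff u s).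
Proof.
elim: xs => [|x xs IH] ux /=; first by rewrite scale1r.
rewrite cliff_anticomm ux ?mem_head// scale0r sub0r IH.
  by rewrite cliffZ -scaleNr exprS mulN1r.
by move=> y yxs; apply: ux; rewrite inE yxs orbT.
Qed.

(** The vector [x] anticommutes with the factors in front of its own occurrence, and there it meets
    itself and squares to zero. *)
Lemma cliff_prod_isotropic xs x s : {in xs &, forall y z, hyp_form y z = 0} ->
  x \in xs -> cliff x (cliff_prod xs s) = 0.
Proof.
elim: xs => // y xs IH iso; rewrite inE => xys /=.
have isoxs : {in xs &, forall y z, hyp_form y z = 0}.
  by move=> a b axs bxs; apply: iso; rewrite inE ?axs ?bxs orbT.
have [xxs|xnxs] := boolP (x \in xs).
  by rewrite cliff_anticomm iso ?mem_head// scale0r sub0r IH// cliff0 oppr0.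
have xy : x = y by move: xys; rewrite (negbTE xnxs) orbF => /eqP.
rewrite -xy in iso *.
(* Anticommuting [x] with itself only yields twice the square, so 2 has to be cancelled. *)
have : 2%:R *: cliff x (cliff x (cliff_prod xs s)) = 0.
  rewrite scaler_nat mulr2n {1}cliff_anticomm iso ?mem_head//.
  by rewrite scale0r sub0r addNr.
by move/eqP; rewrite scaler_eq0 pnatr_eq0 => /eqP.
Qed.

(* Taking the graded commutator with [u] contracts the product. *)
Lemma cliff_prod_contract u x xs : hyp_form u x != 0 ->
  {in xs, forall y, hyp_form u y = 0} ->
  (forall s, cliff x (cliff_prod xs s) = 0) -> forall s, cliff_prod xs s = 0.
Proof.
move=> ux uxs xs0 s; have := cliff_anticomm u x (cliff_prod xs s).
rewrite xs0 cliff0 cliff_prod_anticomm// cliffZ xs0 scaler0 subr0.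
by move/esym/eqP; rewrite scaler_eq0 (negbTE ux) => /eqP.
Qed.

(** Single rows give access to matrix rank theory, pairs to the Clifford action. *)
Definition split_row (x : 'rV[K]_(n + n)) : 'rV[K]_n * 'rV[K]_n :=
  (lsubmx x, rsubmx x).

(** Non-degeneracy of the hyperbolic form: exchanging the two halves of a column gives the vector
    that represents the corresponding linear form. *)
Lemma hyp_form_mulmx (x : 'rV[K]_(n + n)) l (B : 'M[K]_(n + n, l)) j :
  hyp_form ((dsubmx (col j B))^T, (usubmx (col j B))^T) (split_row x) =
  (x *m B) 0 j.
Proof.
have -> : (x *m B) 0 j = (x *m col j B) 0 0.
  by rewrite !mxE; apply: eq_bigr => i _; rewrite mxE.
set z := col j B; rewrite -[x in RHS]hsubmxK -[z in RHS]vsubmxK.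
rewrite mul_row_col !mxE -big_split.
by apply: eq_bigr => i _ /=; rewrite !mxE mulrC [X in _ + X]mulrC addrC.
Qed.

(** Induction on the list of factors: if the longer product were zero on all spinors, contracting
    with a vector dual to its first factor would make the shorter one zero too. *)
Lemma cliff_prod_rows k (A : 'M[K]_(k, n + n)) (s0 : V) : s0 != 0 ->
  row_free A ->
  exists s, cliff_prod [seq split_row (row i A) | i <- enum 'I_k] s != 0.
Proof.
move=> s00 /row_freeP[B AB].
suff main (r : seq 'I_k) : uniq r ->
    exists s, cliff_prod [seq split_row (row i A) | i <- r] s != 0.
  exact/main/enum_uniq.
elim: r => [_|i r IH /=]; first by exists s0.
case/andP => ir /IH[s hs]; apply: contrapT => /forallNP nz.
(* Column [i] of a right inverse of [A] represents the form that is 1 on row [i] and 0 on the other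
   rows. *)
pose u := ((dsubmx (col i B))^T, (usubmx (col i B))^T).
have dual j : hyp_form u (split_row (row j A)) = (j == i)%:R.
  by rewrite hyp_form_mulmx -row_mul AB !mxE.
move/eqP: hs; apply.
apply: (cliff_prod_contract (u := u) (x := split_row (row i A))) => [||t];
  last by apply/eqP; have /negP := nz t; rewrite negbK.
  by rewrite dual eqxx oner_eq0.
move=> _ /mapP[j jr ->]; rewrite dual; case: eqVneq => // ji.
by rewrite -ji jr in ir.
Qed.

(** If [x] is outside the row space, some column of the cokernel of [A] pairs non-trivially with [x]
    and trivially with every row. Contracting with it makes the product of the rows zero, against
    [cliff_prod_rows]. *)
Lemma cliff_prod_annihilator k (A : 'M[K]_(k, n + n)) (x : 'rV[K]_(n + n))
    (s0 : V) : s0 != 0 -> row_free A ->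
  (forall s, cliff (split_row x)
     (cliff_prod [seq split_row (row i A) | i <- enum 'I_k] s) = 0) ->
  (x <= A)%MS.
Proof.
move=> s00 fA x0; apply: contrapT => /negP xA.
have [s /eqP] := cliff_prod_rows s00 fA; apply.
have [j xj] : exists j, (x *m cokermx A) 0 j != 0.
  by move: xA; rewrite submxE => /rV0Pn.
pose z := col j (cokermx A).
move: s; apply: (cliff_prod_contract (u := ((dsubmx z)^T, (usubmx z)^T)) _ _ x0).
  by rewrite hyp_form_mulmx; exact: xj.
by move=> _ /mapP[i _ ->]; rewrite hyp_form_mulmx -row_mul mulmx_coker !mxE.
Qed.

End HyperbolicAction.

(** * Null frames *)

Section NullFrame.
Context {R : realType} {m n : nat} {M : manifold R m}.
Context {g : M -> tvec M -> tvec M -> R} (metric_g : is_metric g).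
Implicit Types (u v w : ctvec M) (p q : M).

Lemma metric_comb2 p (a b : R) (x y z t : tvec M) : tangent p x -> tangent p y ->
  tangent p z -> tangent p t ->
  g p (fun f => a * x f + (b * y f + z f)) t =
  a * g p x t + (b * g p y t + g p z t).
Proof.
move=> tx ty tz tt; rewrite (metric_linear metric_g)//; last exact: tangent_comb.
by rewrite (metric_linear metric_g).
Qed.

Lemma cmetric_comb p (z : R[i]) u v w : ctangent p u -> ctangent p v ->
  ctangent p w ->
  cmetric g p (fun f => z * u f + v f) w = z * cmetric g p u w + cmetric g p v w.
Proof.
move=> [u1 u2] [v1 v2] [w1 w2]; rewrite /cmetric !reV_comb !imV_comb.
rewrite !metric_comb2//; case: z => a b /=.
by apply/eqP; rewrite eq_complex /=; apply/andP; split; apply/eqP; ring.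
Qed.

Lemma cmetricC p u v : ctangent p u -> ctangent p v ->
  cmetric g p u v = cmetric g p v u.
Proof.
move=> [u1 u2] [v1 v2]; rewrite /cmetric.
rewrite (Defs.metric_sym metric_g u1 v1) (Defs.metric_sym metric_g u2 v2).
by rewrite (Defs.metric_sym metric_g u1 v2) (Defs.metric_sym metric_g u2 v1);
  congr (_ +i* _); rewrite addrC.
Qed.

Lemma cmetric0 p w : ctangent p w -> cmetric g p (fun=> 0) w = 0.
Proof.
move=> tw; have := cmetric_comb 1 (ctangent0 p) (ctangent0 p) tw.
under eq_fun do rewrite mulr0 addr0.
by rewrite mul1r => /esym/eqP; rewrite -subr_eq0 addrK => /eqP.
Qed.

Lemma cmetric_sum p (J : Type) (s : seq J) (a : J -> R[i]) (x : J -> ctvec M) w :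
  (forall j, ctangent p (x j)) -> ctangent p w ->
  cmetric g p (fun f => \sum_(j <- s) a j * x j f) w =
  \sum_(j <- s) a j * cmetric g p (x j) w.
Proof.
move=> tx tw; elim: s => [|j s IH].
  by rewrite big_nil; under eq_fun do rewrite big_nil; exact: cmetric0.
rewrite big_cons -IH -cmetric_comb//; last exact: ctangent_sum.
by under eq_fun do rewrite big_cons.
Qed.

Lemma csmooth_cmetric (X Y : M -> ctvec M) : cvfield X -> cvfield Y ->
  csmooth (fun p => cmetric g p (X p) (Y p)).
Proof.
move=> [X1 X2] [Y1 Y2]; have sg := metric_smooth metric_g; split => /=.
  under eq_fun do rewrite -mulN1r.
  apply: (smooth_onD openT (sg _ _ X1 Y1)).
  exact: smooth_onM openT (smooth_on_cst _ openT) (sg _ _ X2 Y2).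
exact: smooth_onD openT (sg _ _ X1 Y2) (sg _ _ X2 Y1).
Qed.

Context {e th : 'I_n -> M -> ctvec M} (frame : is_null_frame g e th).

Local Notation coord := (frame_coord e th).

Lemma ctangent_e p i : ctangent p (e i p).
Proof. exact: cvfield_ctangent (frame_e frame i). Qed.

Lemma ctangent_th p i : ctangent p (th i p).
Proof. exact: cvfield_ctangent (frame_th frame i). Qed.

Lemma ctangent_frame_comb p ab : ctangent p (frame_comb e th p ab).
Proof.
have := ctangent_comb 1 (ctangent_sum (index_enum _) (ab.1 0) (ctangent_e p))
  (ctangent_sum (index_enum _) (ab.2 0) (ctangent_th p)).
by under eq_fun do rewrite mul1r.
Qed.

Lemma frame_coordK p v : ctangent p v -> frame_comb e th p (coord p v) = v.
Proof.
move=> /(frame_basis frame)[ab [vE _]].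
by apply/esym; apply: (@xgetPex _ 0 [set ab | v = frame_comb e th p ab]); exists ab.
Qed.

Lemma frame_combK p ab : coord p (frame_comb e th p ab) = ab.
Proof.
have t := ctangent_frame_comb p ab.
have [ab' [_ uniq_ab]] := frame_basis frame t.
by rewrite -[RHS](uniq_ab ab erefl); apply/esym/uniq_ab; rewrite frame_coordK.
Qed.

Lemma frame_coord_comb p (z : R[i]) u v : ctangent p u -> ctangent p v ->
  coord p (fun f => z * u f + v f) = z *: coord p u + coord p v.
Proof.
move=> tu tv; rewrite -[RHS](frame_combK p); congr (coord p _).
rewrite -{1}(frame_coordK tu) -{1}(frame_coordK tv); apply/funext => f.
rewrite /frame_comb mulrDr addrACA !mulr_sumr; congr (_ + _);
by rewrite -big_split; apply: eq_bigr => i _; rewrite /= !mxE mulrDl mulrA.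
Qed.

Lemma frame_coord0 p : coord p (fun=> 0) = 0.
Proof.
rewrite -[RHS](frame_combK p); congr (coord p _); apply/funext => f.
by rewrite /frame_comb !big1 ?addr0// => i _; rewrite mxE mul0r.
Qed.

Lemma frame_coord_sum p (J : Type) (s : seq J) (a : J -> R[i])
    (x : J -> ctvec M) : (forall j, ctangent p (x j)) ->
  coord p (fun f => \sum_(j <- s) a j * x j f) = \sum_(j <- s) a j *: coord p (x j).
Proof.
move=> tx; elim: s => [|j s IH].
  by rewrite big_nil; under eq_fun do rewrite big_nil; exact: frame_coord0.
rewrite big_cons -IH -frame_coord_comb//; last exact: ctangent_sum.
by under eq_fun do rewrite big_cons.
Qed.

Lemma cmetric_frame_comb p ab w : ctangent p w ->
  cmetric g p (frame_comb e th p ab) w =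
  \sum_i ab.1 0 i * cmetric g p (e i p) w +
  \sum_j ab.2 0 j * cmetric g p (th j p) w.
Proof.
move=> tw; rewrite -cmetric_sum//; last exact: ctangent_e.
rewrite -cmetric_sum//; last exact: ctangent_th.
rewrite -[X in _ = X + _]mul1r -cmetric_comb//; first last.
- by apply: ctangent_sum => j; exact: ctangent_th.
- by apply: ctangent_sum => j; exact: ctangent_e.
by under [in RHS]eq_fun do rewrite mul1r.
Qed.

(** Pairing with [th i] isolates the coefficient of [e i], and 2 undoes the normalization of the
    frame. Through this formula the coordinates of a smooth field are seen to be smooth. *)
Lemma frame_coord1E p v i : ctangent p v ->
  (coord p v).1 0 i = 2 * cmetric g p (v) (th i p).
Proof.
move=> tv; rewrite -{2}(frame_coordK tv) cmetric_frame_comb;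
  last exact: ctangent_th.
rewrite [X in _ + X]big1 => [|j _]; last by rewrite (frame_thth frame) mulr0.
rewrite addr0 (bigD1 i)//= big1 => [|j ji].
  by rewrite (frame_eth frame) eqxx addr0 mulrCA mulfV ?mulr1// pnatr_eq0.
by rewrite (frame_eth frame) (negbTE ji) mulr0.
Qed.

Lemma frame_coord2E p v i : ctangent p v ->
  (coord p v).2 0 i = 2 * cmetric g p v (e i p).
Proof.
move=> tv; rewrite -{2}(frame_coordK tv) cmetric_frame_comb; last exact: ctangent_e.
rewrite [X in X + _]big1 => [|j _]; last by rewrite (frame_ee frame) mulr0.
have eth j : cmetric g p (th j p) (e i p) = if i == j then 2^-1 else 0.
  by rewrite cmetricC ?(frame_eth frame)//; [exact: ctangent_th|exact: ctangent_e].
rewrite add0r (bigD1 i)//= big1 => [|j ji].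
  by rewrite eth eqxx addr0 mulrCA mulfV ?mulr1// pnatr_eq0.
by rewrite eth eq_sym (negbTE ji) mulr0.
Qed.

Lemma hyp_form_coord p u v : ctangent p u -> ctangent p v ->
  hyp_form (coord p u) (coord p v) = 2 * cmetric g p u v.
Proof.
move=> tu tv; rewrite -[u in RHS](frame_coordK tu) cmetric_frame_comb//.
rewrite /hyp_form -big_split mulr_sumr; apply: eq_bigr => i _ /=.
rewrite frame_coord1E// [(coord p v).2 _ _]frame_coord2E//.
rewrite [cmetric g p v (e _ _)]cmetricC//; last exact: ctangent_e.
rewrite [(coord p v).1 _ _]frame_coord1E//.
rewrite [cmetric g p v (th _ _)]cmetricC//; last exact: ctangent_th.
by ring.
Qed.

Lemma csmooth_coord (X : M -> ctvec M) i : cvfield X ->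
  csmooth (fun p => (coord p (X p)).1 0 i) /\
  csmooth (fun p => (coord p (X p)).2 0 i).
Proof.
move=> vX; split.
  rewrite (_ : (fun p => _) = (fun p => 2 * cmetric g p (X p) (th i p))).
    apply: (csmooth_onM openT (csmooth_on_cst _ openT)).
    exact: csmooth_cmetric vX (frame_th frame i).
  by apply/funext => p; exact/frame_coord1E/cvfield_ctangent.
rewrite (_ : (fun p => _) = (fun p => 2 * cmetric g p (X p) (e i p))).
  apply: (csmooth_onM openT (csmooth_on_cst _ openT)).
  exact: csmooth_cmetric vX (frame_e frame i).
by apply/funext => p; exact/frame_coord2E/cvfield_ctangent.
Qed.

Definition coord_row p v : 'rV[R[i]]_(n + n) :=
  row_mx (coord p v).1 (coord p v).2.

Lemma split_coord_row p v : split_row (coord_row p v) = coord p v.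
Proof. by rewrite /split_row row_mxKl row_mxKr; case: (coord p v). Qed.

Lemma coord_row_inj p u v : ctangent p u -> ctangent p v ->
  coord_row p u = coord_row p v -> u = v.
Proof.
move=> tu tv /(congr1 (@split_row _ _)); rewrite !split_coord_row => uv.
by rewrite -(frame_coordK tu) uv frame_coordK.
Qed.

Lemma coord_row_sum p k (a : 'I_k -> R[i]) (x : 'I_k -> ctvec M) :
  (forall j, ctangent p (x j)) ->
  coord_row p (fun f => \sum_j a j * x j f) = \sum_j a j *: coord_row p (x j).
Proof.
move=> tx; rewrite /coord_row frame_coord_sum//.
elim: (index_enum _) => [|j s IH]; first by rewrite !big_nil row_mx0.
by rewrite !big_cons -IH /= scale_row_mx add_row_mx.
Qed.

Lemma coord_row0 p : coord_row p (fun=> 0) = 0.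
Proof. by rewrite /coord_row frame_coord0 row_mx0. Qed.

End NullFrame.

(** * Sections of the pure subspace *)

Section SpinorFields.
Context {R : realType} {m n : nat} {M : manifold R m}.
Context {g : M -> tvec M -> tvec M -> R} (metric_g : is_metric g).
Context {e th : 'I_n -> M -> ctvec M} (frame : is_null_frame g e th).

Local Notation coord := (frame_coord e th).
Local Notation coord_rowN := (coord_row (e := e) (th := th)).
Local Notation spin_cliff := (cliff (@contract_lin R n) (@wedge_lin R n)).
Local Notation spin_prod := (cliff_prod (@contract_lin R n) (@wedge_lin R n)).

Lemma cliffordE p v (s : spinor R n) :
  clifford e th p v s = spin_cliff (coord p v) s.
Proof. by []. Qed.

Lemma spinor_field_clifford (X : M -> ctvec M) (phi : M -> spinor R n) :
  cvfield X -> spinor_field phi ->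
  spinor_field (fun p => clifford e th p (X p) (phi p)).
Proof.
move=> vX sphi T; have sX i := csmooth_coord metric_g frame i vX.
rewrite (_ : (fun p => _) = (fun p =>
   \sum_i (coord p (X p)).1 0 i * contract i (phi p) T +
   \sum_j (coord p (X p)).2 0 j * wedge j (phi p) T)); last first.
  apply/funext => p; rewrite /clifford ffunE 2!sum_ffunE.
  by congr (_ + _); apply: eq_bigr => i _; rewrite ffunE.
apply: (csmooth_onD openT); apply: (csmooth_on_sum _ openT) => i.
  apply: (csmooth_onM openT (sX i).1).
  under eq_fun do rewrite ffunE; case: (i \in T); first exact: csmooth_on_cst openT.
  exact: csmooth_onM openT (csmooth_on_cst _ openT) (sphi _).
apply: (csmooth_onM openT (sX i).2).
under eq_fun do rewrite ffunE; case: (i \in T); last exact: csmooth_on_cst openT.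
exact: csmooth_onM openT (csmooth_on_cst _ openT) (sphi _).
Qed.

Lemma spinor_field_prod (J : Type) (r : seq J) (X : J -> M -> ctvec M)
    (s : spinor R n) : (forall j, cvfield (X j)) ->
  spinor_field (fun p => spin_prod [seq coord p (X j p) | j <- r] s).
Proof.
move=> vX; elim: r => [|j r IH] /=; last exact: spinor_field_clifford (vX j) IH.
by move=> T; exact: csmooth_on_cst openT.
Qed.

Lemma spinor_fieldZ (h : M -> R[i]) (phi : M -> spinor R n) :
  csmooth h -> spinor_field phi -> spinor_field (fun p => h p *: phi p).
Proof.
move=> sh sphi T; under eq_fun do rewrite ffunE.
exact: csmooth_onM openT sh (sphi T).
Qed.

(** Polarization: isotropy of [u + v], [u] and [v] makes twice the metric pairing of [u] and [v]
    vanish. *)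
Lemma isotropic_hyp_form (I : M -> set (ctvec M)) p u v :
  isotropic_distribution g I -> I p u -> I p v ->
  hyp_form (coord p u) (coord p v) = 0.
Proof.
move=> [sI iso] Iu Iv; have tu := subbundle_ctangent sI Iu.
have tv := subbundle_ctangent sI Iv.
rewrite (hyp_form_coord metric_g frame tu tv).
have := iso p _ (subbundle_comb 1 sI Iu Iv).
have tuv := ctangent_comb 1 tu tv.
rewrite (cmetric_comb metric_g)// mul1r (cmetricC metric_g tu)//.
rewrite (cmetricC metric_g tv)// !(cmetric_comb metric_g)// !iso//.
by rewrite mulr0 add0r mul1r addr0 (cmetricC metric_g tv tu) -mulr2n mulr_natl.
Qed.

(* Multiplying by all the vectors of a local frame of [I] yields enough sections
   of the pure subspace to recover [I]. *)
Lemma pure_subspace_annihilator (I : M -> set (ctvec M)) p w :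
  isotropic_distribution g I -> ctangent p w ->
  (forall phi, spinor_field_in (pure_subspace e th I) phi ->
     clifford e th p w (phi p) = 0) ->
  I p w.
Proof.
move=> isoI tw kill; have sI := isoI.1.
have [k [b [V [sb bp VI spanV]]]] := subbundle_frame p sI.
have tV q i : ctangent q (V i q) by apply: cvfield_ctangent; have [] := VI i.
(* The factor [b] keeps the field pure at points where the [V i] fail to span [I]: it is zero
   there. *)
pose phi (s0 : spinor R n) q : spinor R n :=
  (b q)%:C *: spin_prod [seq coord q (V i q) | i <- enum 'I_k] s0.
have phi_pure s0 : spinor_field_in (pure_subspace e th I) (phi s0).
  split.
    apply: spinor_fieldZ; first by split; [exact: sb|exact: smooth_on_cst openT].
    by apply: spinor_field_prod => i; have [] := VI i.
  move=> q v Iv; rewrite cliffordE /phi cliffZ.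
  have [->|bq] := eqVneq (b q) 0; first by rewrite scale0r.
  have [_ /(_ v Iv)[a ->]] := spanV q bq.
  rewrite (frame_coord_sum frame)// cliff_suml big1 ?scaler0// => i _.
  suff -> : spin_cliff (coord q (V i q))
      (spin_prod [seq coord q (V j q) | j <- enum 'I_k] s0) = 0.
    exact: scaler0.
  apply: (cliff_prod_isotropic (@contract_lin_anticomm R n)
      (@wedge_lin_anticomm R n) (@contract_wedge_lin R n)).
    move=> _ _ /mapP[j _ ->] /mapP[l _ ->].
    by apply: (isotropic_hyp_form isoI); [have [] := VI j|have [] := VI l].
  by apply/mapP; exists i => //; rewrite mem_enum.
(* The rows are the frame vectors at [p]; since [b p] is non-zero they are independent, and the row
   space of [A] corresponds to the fibre of [I]. *)
pose A := \matrix_(i < k) coord_rowN p (V i p).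
have fA : row_free A.
  apply: inj_row_free => a; rewrite mulmx_sum_row => aA.
  have [free _] := spanV p bp; apply/rowP => i; rewrite mxE.
  apply: (free (a 0)); apply: (coord_row_inj frame (p := p)).
  - exact: ctangent_sum.
  - exact: ctangent0.
  rewrite (coord_row_sum frame)// (coord_row0 frame) -[RHS]aA.
  by apply: eq_bigr => j _; rewrite rowK.
have s0 : ([ffun=> 1] : spinor R n) != 0.
  by apply/eqP => /ffunP/(_ finset.set0)/eqP; rewrite !ffunE oner_eq0.
have /submxP[a wA] : (coord_rowN p w <= A)%MS.
  apply: (cliff_prod_annihilator (@contract_lin_anticomm R n)
      (@wedge_lin_anticomm R n) (@contract_wedge_lin R n) s0 fA).
  move=> s; rewrite split_coord_row.
  have := kill _ (phi_pure s); rewrite cliffordE /phi cliffZ.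
  move/eqP; rewrite scaler_eq0 fmorph_eq0 (negbTE bp) /= => /eqP <-.
  by congr (spin_cliff _ (spin_prod _ _)); apply: eq_map => i;
    rewrite rowK split_coord_row.
have -> : w = (fun f => \sum_i a 0 i * V i p f).
  apply: (coord_row_inj frame tw (ctangent_sum _ _ (tV p))).
  rewrite (coord_row_sum frame)// wA mulmx_sum_row.
  by apply: eq_bigr => i _; rewrite rowK.
by apply: subbundle_sum => // i; have [_] := VI i.
Qed.

End SpinorFields.

(** * The complexified Levi-Civita connection *)

Section LeviCivita.
Context {R : realType} {m : nat} {M : manifold R m}.
Context {g : M -> tvec M -> tvec M -> R}
  {D : (M -> tvec M) -> (M -> tvec M) -> M -> tvec M} (lc_D : levi_civita g D).

Lemma cvfield_cextend (X Y : M -> ctvec M) : cvfield X -> cvfield Y ->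
  cvfield (cextend D X Y).
Proof.
have comb (c : R) (Z T : M -> tvec M) : vfield Z -> vfield T ->
    vfield (fun p f => c * Z p f + T p f).
  by move=> vZ vT; apply: (vfield_on_comb openT (smooth_on_cst c openT) vZ vT).
move=> [X1 X2] [Y1 Y2]; split.
  have := comb (- 1) _ _ (lc_vfield lc_D X2 Y2) (lc_vfield lc_D X1 Y1).
  by under eq_fun do under eq_fun do rewrite mulN1r addrC.
have := comb 1 _ _ (lc_vfield lc_D X1 Y2) (lc_vfield lc_D X2 Y1).
by under eq_fun do under eq_fun do rewrite mul1r.
Qed.

(** The right-hand side is written as a combination with coefficient [-1] so that [subbundle_comb]
    and [cvfield_on_comb] apply to it directly. *)
Lemma cextend_torsion_free (X Y : M -> ctvec M) : cvfield X -> cvfield Y ->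
  cextend lie_bracket X Y =
  (fun p f => -1 * cextend D Y X p f + cextend D X Y p f).
Proof.
move=> [X1 X2] [Y1 Y2]; rewrite /cextend.
rewrite -(lc_torsion_free lc_D X1 Y1) -(lc_torsion_free lc_D X2 Y2).
rewrite -(lc_torsion_free lc_D X1 Y2) -(lc_torsion_free lc_D X2 Y1).
apply/funext => p; apply/funext => f; rewrite mulN1r.
by apply/eqP; rewrite eq_complex /=; apply/andP; split; apply/eqP; ring.
Qed.

Lemma totally_geodesic_integrable (I : M -> set (ctvec M)) :
  subbundle I -> totally_geodesic D I -> integrable_distribution I.
Proof.
move=> sI tg X Y IX IY; have [DXY IDXY] := tg _ _ IX IY.
have [DYX IDYX] := tg _ _ IY IX.
rewrite cextend_torsion_free; [|exact: IX.1|exact: IY.1].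
split; first exact: cvfield_on_comb openT (csmooth_on_cst _ openT) DYX DXY.
by move=> p; exact: subbundle_comb.
Qed.

End LeviCivita.

Theorem theorem3 (R : realType) (n : nat) (M : manifold R n.*2)
  (g : M -> tvec M -> tvec M -> R) (metric_g : is_metric g)
  (D : (M -> tvec M) -> (M -> tvec M) -> M -> tvec M)
  (lc_D : levi_civita g D)
  (e th : 'I_n -> M -> ctvec M) (frame_eth : is_null_frame g e th)
  (I : M -> set (ctvec M)) (isotropic_I : isotropic_distribution g I)
  (hD : (M -> ctvec M) -> (M -> spinor R n) -> M -> spinor R n)
  (spin_hD : spinorial_connection e th D hD) :
  (integrable_distribution I /\ totally_geodesic D I) <->
  (forall X phi, vfield_in I X -> spinor_field_in (pure_subspace e th I) phi ->
     spinor_field_in (pure_subspace e th I) (hD X phi)).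
Proof.
have sI := isotropic_I.1.
(* Additivity applied to [0 + 0]. *)
have hD0 X : cvfield X -> hD X (fun=> 0) = (fun=> 0).
  move=> vX; have s0 : spinor_field (fun _ : M => 0 : spinor R n).
    by move=> T; exact: csmooth_on_cst openT.
  have h := sc_additive spin_hD vX s0 s0.
  rewrite (_ : (fun=> 0 + 0) = (fun=> 0)) in h; last first.
    by apply/funext => p; rewrite addr0.
  apply/funext => p; have /eqP := congr1 (@^~ p) h.
  by rewrite -[X in X == _]addr0 => /eqP/addrI.
(* The Leibniz rule applied to [Y phi = 0]. *)
have leibniz X Y phi p : vfield_in I X -> vfield_in I Y ->
    spinor_field_in (pure_subspace e th I) phi ->
    clifford e th p (cextend D X Y p) (phi p) +
    clifford e th p (Y p) (hD X phi p) = 0.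
  move=> [vX _] [vY IY] [sphi Lphi].
  have := congr1 (@^~ p) (sc_clifford spin_hD vX vY sphi).
  rewrite (_ : (fun q => _) = (fun=> 0)) ?hD0//.
  by apply/funext => q; exact: Lphi.
split=> [[_ tg] X phi IX Lphi|pure].
  split; first exact: sc_field spin_hD _ _ IX.1 Lphi.1.
  (* Purity at [p] concerns single vectors; each is the value of a global field [Y] of [I], to which
     the Leibniz rule applies. *)
  move=> p v Iv; have [Y IY Yp] := subbundle_extend sI Iv.
  have := leibniz X Y phi p IX IY Lphi.
  by rewrite Yp Lphi.2 ?add0r//; have [_] := tg X Y IX IY; exact.
suff tg : totally_geodesic D I.
  by split; [exact: totally_geodesic_integrable lc_D _ sI tg|exact: tg].
move=> X Y IX IY; have vDXY := cvfield_cextend lc_D IX.1 IY.1.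
split=> // p; apply: (pure_subspace_annihilator metric_g frame_eth isotropic_I).
  exact: cvfield_ctangent.
move=> phi Lphi; have := leibniz X Y phi p IX IY Lphi.
(* The derivative of [phi] is pure, so [Y] kills it and only the action of [cextend D X Y] on [phi]
   remains. *)
by rewrite ((pure X phi IX Lphi).2 p (Y p) (IY.2 p)) addr0.
Qed.
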